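(* Let $(\omega(e))_{e\in\mathcal{E}}$ be independent random variables indexed by the directed edges of the oriented half-plane lattice $\mathbb{H}$, where $\omega(e)$ is exponentially distributed with rate $2^{h(e)}$ (mean $2^{-h(e)}$), and let $\mathbb{S}$ denote their joint law. For $x\in\partial\mathbb{H}$ let $$S(x)=\bigcup_{y\in\mathbb{H}}\{\gamma:\ \gamma\text{ is an oriented path from }x\text{ to }y,\ \lambda(\gamma)=d_\omega(y,\partial\mathbb{H})\}.$$ Then $S(0)$ is finite $\mathbb{S}$-almost surely.
   Context: **Lattice.** $\mathbb{H}=\{(x,y)\in\mathbb{Z}^2: x+y\in 2\mathbb{Z},\ y\ge 0\}$, $\theta_l=(-1,1)$, $\theta_r=(1,1)$. It is a directed graph: each $v\in\mathbb{H}$ has exactly the outgoing edges $(v,v+\theta_l)$ and $(v,v+\theta_r)$; $\mathcal{E}$ is the set of directed edges. For $v=(x,y)$, $h(v)=y$; for an edge $e=(v,w)$, $h(e)=\max\{h(v),h(w)\}$. $\partial\mathbb{H}=\{(x,0):x\in 2\mathbb{Z}\}$, and $0=(0,0)\in\partial\mathbb{H}$. **First passage percolation.** An oriented path is a finite sequence of consecutive directed edges $\gamma=(e_1,\dots,e_n)$; its length is $\lambda(\gamma)=\sum_{i=1}^n\omega(e_i)$. If there is an oriented path from $x$ to $y$, $d_\omega(x,y)=\min_{\gamma:x\to y}\lambda(\gamma)$, the minimum over the finitely many oriented paths from $x$ to $y$. For $y\in\mathbb{H}$, $d_\omega(y,\partial\mathbb{H})$ is the minimum of $d_\omega(x,y)$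 over those $x\in\partial\mathbb{H}$ from which $y$ can be reached by an oriented path. The union defining $S(x)$ is understood as the set of all edges lying on such minimizing paths. *)

(* Defs.v *)
From HB Require Import structures.
From mathcomp Require Import all_boot all_order all_algebra.
From mathcomp Require Import all_classical all_reals all_analysis.

Set Implicit Arguments.
Unset Strict Implicit.
Unset Printing Implicit Defensive.

Import Order.TTheory GRing.Theory Num.Theory.

Local Open Scope classical_set_scope.
Local Open Scope ring_scope.

(** * The oriented half-plane lattice *)

Definition vertex :=
  {v : int * int | (2 %| v.1 + v.2)%Z && (0 <= v.2)}.
HB.instance Definition _ := Countable.on vertex.
HB.instance Definition _ := SubType.on vertex.

Definition theta_l : int * int := (-1, 1).
Definition theta_r : int * int := (1, 1).

Definition edge :=
  {e : vertex * vertex | (val e.2 == val e.1 + theta_l)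
                      || (val e.2 == val e.1 + theta_r)}.
HB.instance Definition _ := Countable.on edge.
HB.instance Definition _ := SubType.on edge.

Definition src (e : edge) : vertex := (val e).1.
Definition tgt (e : edge) : vertex := (val e).2.

Definition vheight (v : vertex) : int := (val v).2.
Definition eheight (e : edge) : int :=
  Num.max (vheight (src e)) (vheight (tgt e)).

Definition boundary : set vertex := [set v | vheight v = 0].

Definition origin : vertex := exist _ (0, 0) isT.

(** * First passage percolation *)

(* The end points are arguments so that the empty path from [x] to [x] makes
   sense: it is the only oriented path leading from the boundary to a boundary
   vertex. *)
Fixpoint oriented_path (x y : vertex) (g : seq edge) : bool :=
  if g is e :: g' then (src e == x) && oriented_path (tgt e) y g' else x == y.

Definition reachable (x y : vertex) : Prop := exists g, oriented_path x y g.

Definition path_length (R : realType) (w : edge -> R) (g : seq edge) : R :=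
  \sum_(e <- g) w e.

(* The least element of [A]; the default value 0 is used only if there is
   none. *)
Definition min_set (R : realType) (A : set R) : R := xget 0 (A `&` lbound A).

(* There are finitely many oriented paths between two vertices, and finitely
   many boundary vertices from which a given vertex can be reached (at least
   one), so the two minima below exist, for the first one if [reachable x y]. *)
Definition dist (R : realType) (w : edge -> R) (x y : vertex) : R :=
  min_set [set path_length w g | g in [set g | oriented_path x y g]].

Definition dist_boundary (R : realType) (w : edge -> R) (y : vertex) : R :=
  min_set [set dist w x y | x in [set x | boundary x /\ reachable x y]].

Definition Sset (R : realType) (w : edge -> R) (x : vertex) : set edge :=
  \bigcup_(y in [set: vertex])
    \bigcup_(g in [set g | oriented_path x y g /\
                           path_length w g = dist_boundary w y])
      [set` g].

(** * Independent exponential variables *)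

Definition mutually_independent d (T : measurableType d) (R : realType)
    (P : probability T R) (I : eqType) (X : I -> {RV P >-> R}) : Prop :=
  forall (s : seq I) (B : I -> set R), uniq s ->
    (forall i, measurable (B i)) ->
    P (\bigcap_(i in [set` s]) (X i @^-1` B i)) =
    (\prod_(i <- s) P (X i @^-1` B i))%E.

(* Equality is required on measurable sets only: elsewhere the values of a
   measure are unspecified. *)
Definition exponentially_distributed d (T : measurableType d) (R : realType)
    (P : probability T R) (X : {RV P >-> R}) (rate : R) : Prop :=
  forall A : set R, measurable A ->
    distribution P X A = exponential_prob rate A.

(* Main.v *)
(* A path from the origin that reaches a vertex of height a + c has to meet the
   theta_r-ray issued from (-2a, 0) or the theta_l-ray issued from (2c, 0). If
   both rays have a total weight smaller than each of the two edges that leave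
   the origin, then no path of S(0) continues beyond that meeting point, since
   following the ray is a strictly shorter way to reach it from the boundary.
   A ray has total weight at most 3 dl as soon as its k-th edge has weight at
   most dl (3/4)^k for all k, which happens with a probability at least
   exp(-2 / dl), because 2^k (3/4)^k = (3/2)^k grows geometrically. Parallel
   rays use disjoint sets of edges, so by independence almost surely both kinds
   of rays occur, whatever the value of dl. *)

Require Import Defs.
From mathcomp Require Import all_boot all_order all_algebra.
From mathcomp Require Import all_classical all_reals all_analysis.
From mathcomp Require Import measurable_realfun zify ring lra.

Import Order.TTheory GRing.Theory Num.Theory.
Import numFieldNormedType.Exports.

Local Open Scope classical_set_scope.
Local Open Scope ring_scope.

(** * Steps, edges and oriented paths of the lattice *)

Definition dir (b : bool) : int * int := if b then theta_r else theta_l.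

Lemma step_subproof (b : bool) (v : vertex) :
  (2 %| (val v + dir b).1 + (val v + dir b).2)%Z && (0 <= (val v + dir b).2).
Proof. by case: v b => [[x y] /= /andP[? ?]] [] /=; lia. Qed.

Definition step (b : bool) (v : vertex) : vertex :=
  exist _ (val v + dir b) (step_subproof b v).

Lemma out_edge_subproof (b : bool) (v : vertex) :
  (val (step b v) == val v + theta_l) || (val (step b v) == val v + theta_r).
Proof. by case: b; rewrite /= eqxx ?orbT. Qed.

Definition out_edge (b : bool) (v : vertex) : edge :=
  exist _ (v, step b v) (out_edge_subproof b v).

Lemma edge_out_edge (e : edge) : exists b, e = out_edge b (src e).
Proof.
case: e => [[v w] /= vw]; case/orP: (vw) => /eqP vwE.
- by exists false; apply/val_inj => /=; congr pair; apply/val_inj.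
- by exists true; apply/val_inj => /=; congr pair; apply/val_inj.
Qed.

Lemma eheight_out_edge (b : bool) (v : vertex) :
  eheight (out_edge b v) = vheight v + 1.
Proof. by rewrite /eheight /vheight; case: v b => [[x y] ?] [] /=; lia. Qed.

Lemma oriented_path_cat {x y z : vertex} {g1 g2 : seq edge} :
  oriented_path x y g1 -> oriented_path y z g2 -> oriented_path x z (g1 ++ g2).
Proof.
elim: g1 x => [|e g1 IH] x /=; first by move/eqP->.
by move=> /andP[-> /=]; apply: IH.
Qed.

(** Each vertex has only two outgoing edges. Finiteness of [Sset] is thereby reduced to a bound on
    the number of edges of its paths. *)
Lemma finite_short_path_edges (n : nat) (x : vertex) :
  finite_set [set e | exists y g,
    [/\ oriented_path x y g, (size g <= n)%N & e \in g]].
Proof.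
elim: n x => [|n IH] x.
  by apply: (@sub_finite_set _ _ set0) => // e [y [[|? ?] []]].
apply: (@sub_finite_set _ _ (\bigcup_(b in [set: bool])
  ([set out_edge b x] `|` [set e | exists y g,
    [/\ oriented_path (step b x) y g, (size g <= n)%N & e \in g]]))).
  move=> e [y [[[]//|e' g] [/= /andP[/eqP xE gP] sg]]].
  have [b e'E] := edge_out_edge e'; rewrite xE in e'E; subst e'.
  rewrite inE => /orP[/eqP ->|eg]; exists b => //; first by left.
  by right; exists y, g.
by apply: bigcup_finite => // b _; rewrite finite_setU.
Qed.

(** * Rays and their crossing by paths *)

(* [2 * (number of steps of a path from the origin to v that go against b)];
   it is constant along the rays of direction [b]. *)
Definition cross (b : bool) (v : vertex) : int :=
  if b then (val v).2 - (val v).1 else (val v).2 + (val v).1.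

(** The shift [a.+1] keeps the origin strictly between the two kinds of rays, even for index 0. *)
Definition ray_start_val (b : bool) (a : nat) : int * int :=
  (if b then - (2 * a.+1%:Z) else 2 * a.+1%:Z, 0).

Lemma ray_start_subproof (b : bool) (a : nat) :
  (2 %| (ray_start_val b a).1 + (ray_start_val b a).2)%Z
    && (0 <= (ray_start_val b a).2).
Proof. by case: b => /=; lia. Qed.

Definition ray_start (b : bool) (a : nat) : vertex :=
  exist _ (ray_start_val b a) (ray_start_subproof b a).

Definition ray_vertex (b : bool) (a k : nat) : vertex :=
  iter k (step b) (ray_start b a).

Definition ray_edge (b : bool) (a k : nat) : edge :=
  out_edge b (ray_vertex b a k).

Definition ray_path (b : bool) (a k : nat) : seq edge :=
  [seq ray_edge b a i | i <- iota 0 k].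

Lemma vheight_ray_vertex (b : bool) (a k : nat) :
  vheight (ray_vertex b a k) = k%:Z.
Proof.
elim: k => //= k; rewrite /vheight /= => ->.
by case: b => /=; lia.
Qed.

Lemma cross_ray_vertex (b : bool) (a k : nat) :
  cross b (ray_vertex b a k) = 2 * a.+1%:Z.
Proof.
elim: k => [|k]; rewrite /cross; case: b => /=; lia.
Qed.

Lemma eheight_ray_edge (b : bool) (a k : nat) :
  eheight (ray_edge b a k) = k.+1%:Z.
Proof. by rewrite eheight_out_edge vheight_ray_vertex; lia. Qed.

Lemma vertex_eq (b : bool) (u v : vertex) :
  vheight u = vheight v -> cross b u = cross b v -> u = v.
Proof.
rewrite /vheight /cross => uvh uvc; apply/val_inj.
by case: u v b uvh uvc => [[? ?] ?] [[? ?] ?] [] /= ? ?; congr pair; lia.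
Qed.

(** The height of the source determines [k], and its [cross] value determines [a]. This disjointness
    is what makes parallel rays independent. *)
Lemma ray_edge_inj (b : bool) (a a' k k' : nat) :
  ray_edge b a k = ray_edge b a' k' -> a = a' /\ k = k'.
Proof.
move=> /(congr1 src); rewrite /src /= => vE.
have := congr1 vheight vE; have := congr1 (cross b) vE.
by rewrite !vheight_ray_vertex !cross_ray_vertex; lia.
Qed.

Lemma ray_path_oriented (b : bool) (a k : nat) :
  oriented_path (ray_start b a) (ray_vertex b a k) (ray_path b a k).
Proof.
elim: k => [|k IH]; first by rewrite /= eqxx.
rewrite /ray_path -addn1 iotaD map_cat; apply: oriented_path_cat IH _.
by rewrite /= addn1 /= !eqxx.
Qed.

(* [A b] is the index of the ray of direction [b]: the two rays and the
   boundary enclose a triangle that contains the origin. *)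
Lemma path_crosses_ray (A : bool -> nat) (x y : vertex) (g : seq edge) :
  oriented_path x y g ->
  (forall b, cross b x < 2 * (A b).+1%:Z) ->
  (2 * ((A true).+1 + (A false).+1)%N%:Z
     <= cross true x + cross false x + 2 * (size g)%:Z) ->
  exists b k e g1 g2,
    [/\ g = e :: g1 ++ g2,
        oriented_path x (ray_vertex b (A b) k) (e :: g1),
        oriented_path (ray_vertex b (A b) k) y g2
      & (k <= (A true).+1 + (A false).+1)%N].
Proof.
elim: g x => [|e g IH] x.
  (* With no edge left, the size bound puts [x] at height at least [(A true).+1 + (A false).+1],
     where both strict bounds cannot hold. *)
  by move=> _ xA; have := xA true; have := xA false; rewrite /=; lia.
move=> /= /andP[/eqP xE gP] xA sg.
have [b eE] := edge_out_edge e; rewrite xE in eE.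
have tE : tgt e = step b x by rewrite eE.
rewrite tE in gP.
(* A step in direction [b] changes only the other [cross] value, so it can meet only the ray of
   direction [~~ b]. *)
have crossb : cross b (step b x) = cross b x.
  by rewrite /cross; case: (b) => /=; lia.
have crossNb : cross (~~ b) (step b x) = cross (~~ b) x + 2.
  by rewrite /cross; case: (b) => /=; lia.
have crossE v : cross true v + cross false v = 2 * vheight v.
  by rewrite /cross /vheight; lia.
(* By parity, a [cross] value growing by 2 cannot jump over [2 * (A c).+1] without attaining it. *)
have even c v : (2 %| cross c v)%Z.
  by rewrite /cross; case: v c => [[? ?] /= /andP[? ?]] [] /=; lia.
have [hit|nohit] := eqVneq (cross (~~ b) (step b x)) (2 * (A (~~ b)).+1%:Z).
  have hk : exists k : nat, vheight (step b x) = k%:Z.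
    exists `|vheight (step b x)|%N.
    have : 0 <= vheight (step b x).
      by have /andP[] := valP (step b x).
    lia.
  have {hk}[k hk] := hk.
  have rE : ray_vertex (~~ b) (A (~~ b)) k = step b x.
    apply: (@vertex_eq (~~ b)); first by rewrite vheight_ray_vertex.
    by rewrite cross_ray_vertex.
  exists (~~ b), k, e, [::], g; split => //=.
  - by rewrite rE xE tE !eqxx.
  - by rewrite rE.
  - have := crossE (step b x); have := xA b; rewrite -crossb hk.
    by case: (b) hit => /= hit; lia.
have [||b' [k [e' [g1 [g2 [gE p1 p2 kA]]]]]] := IH _ gP.
- move=> c; have := xA c; have := even c (step b x).
  by case: (b) c crossb crossNb nohit => [] [] /= crossb crossNb nohit; lia.
(* One edge is lost and the sum of the two [cross] values gains 2, so the bound is preserved. *)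
- by move: sg crossb crossNb; case: (b) => /=; lia.
exists b', k, e, (e' :: g1), g2; split => //; first by rewrite gE.
by rewrite /= -/(oriented_path _ _ (e' :: g1)) xE eqxx tE.
Qed.

(** * First passage percolation for fixed nonnegative weights *)

Section first_passage.
Context {R : realType} (w : edge -> R).
Hypothesis w_ge0 : forall e, 0 <= w e.

(* If [A] has no least element then [min_set A = 0], so that no existence of
   minima is needed here. *)
Lemma min_set_ge0 (A : set R) : (forall a, A a -> 0 <= a) -> 0 <= min_set A.
Proof. by rewrite /min_set => A0; case: xgetP => // x _ [/A0]. Qed.

Lemma min_set_le (A : set R) (a : R) :
  (forall a, A a -> 0 <= a) -> A a -> min_set A <= a.
Proof.
by rewrite /min_set => A0 Aa; case: xgetP => [x _ [_]|_]; [exact|exact: A0].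
Qed.

Lemma path_length_ge0 (g : seq edge) : 0 <= path_length w g.
Proof. by apply: sumr_ge0 => e _; exact: w_ge0. Qed.

Lemma dist_boundary_le {x y : vertex} {g : seq edge} :
  boundary x -> oriented_path x y g -> dist_boundary w y <= path_length w g.
Proof.
move=> bx gP.
have dist_ge0 z : 0 <= dist w z y.
  by apply: min_set_ge0 => _ [h _ <-]; exact: path_length_ge0.
apply: (@le_trans _ _ (dist w x y)).
  apply: min_set_le; first by move=> _ [z _ <-]; exact: dist_ge0.
  by exists x => //; split => //; exists g.
apply: min_set_le; last by exists g.
by move=> _ [h _ <-]; exact: path_length_ge0.
Qed.

Definition threshold (dl : R) (k : nat) : R := dl * (3 / 4) ^+ k.

Lemma ray_path_length_le (dl : R) (b : bool) (a k : nat) : 0 <= dl ->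
  (forall i, (i < k)%N -> w (ray_edge b a i) <= threshold dl i.+1) ->
  path_length w (ray_path b a k) <= 3 * dl.
Proof.
move=> dl0 wle; rewrite /path_length big_map.
(* This is the exact sum of the thresholds of index 1 to [k]; edge [i] has height [i.+1]. *)
apply: (@le_trans _ _ (3 * dl * (1 - (3 / 4) ^+ k))).
  elim: k wle => [|k IH] wle; first by rewrite big_nil expr0 subrr mulr0.
  rewrite -addn1 iotaD big_cat big_seq1 add0n.
  have {}IH := IH (fun i ik => wle i (ltnW ik)).
  have := wle k (ltnSn k); rewrite /threshold addn1 exprS.
  by move: IH; rewrite /=; lra.
by rewrite -[leRHS]mulr1 ler_wpM2l ?mulr_ge0// gerBl exprn_ge0.
Qed.

Lemma finite_Sset (dl : R) (A : bool -> nat) : 0 <= dl ->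
  (forall b, 3 * dl < w (out_edge b origin)) ->
  (forall b i, (i < (A true).+1 + (A false).+1)%N ->
     w (ray_edge b (A b) i) <= threshold dl i.+1) ->
  finite_set (Sset w origin).
Proof.
move=> dl0 w0 wray; set N := ((A true).+1 + (A false).+1)%N in wray.
apply: sub_finite_set (finite_short_path_edges N origin).
move=> e [y _ [g [gP glen] /= eg]]; exists y, g; split => //.
rewrite leqNgt; apply/negP => Ng.
have [||b [k [e0 [g1 [g2 [gE p1 p2 kN]]]]]] := @path_crosses_ray A _ _ _ gP.
- by case.
- by rewrite -/N /=; lia.
(* The competitor follows the ray to the meeting point and then the same tail [g2], which cancels in
   the comparison of lengths. *)
have p3 := oriented_path_cat (ray_path_oriented b (A b) k) p2.
have := @dist_boundary_le (ray_start b (A b)) _ _ erefl p3.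
rewrite -glen gE -cat_cons /path_length !big_cat /= lerD2r big_cons.
apply/negP; rewrite -ltNge.
have /andP[/eqP e0src _] := p1.
have [c e0E] := edge_out_edge e0.
apply: (@le_lt_trans _ _ (3 * dl)).
  by apply: ray_path_length_le => // i ik; apply: wray; exact: leq_trans kN.
rewrite e0E e0src (lt_le_trans (w0 c))// lerDl.
exact: path_length_ge0.
Qed.

End first_passage.

(** * Countable unions, independence and the exponential law *)

Lemma negligible_bigcup_countable {d} {T : measurableType d} {R : realType}
    (mu : {measure set T -> \bar R}) (I : countType) (F : I -> set T) :
  (forall i, mu.-negligible (F i)) -> mu.-negligible (\bigcup_i F i).
Proof.
move=> negF.
apply: (@negligibleS _ _ _ _ (\bigcup_n
    (if unpickle n is Some i then F i else set0))).
  by move=> t [i _ Fit]; exists (pickle i); rewrite ?pickleK.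
by apply: negligible_bigcup => n; case: unpickle => //; exact: negligible_set0.
Qed.

Section independence.
Context {d} {T : measurableType d} {R : realType} (P : probability T R).

Lemma probability_bigsetI_setC (I : eqType) (A : I -> set T) (q : I -> R) :
  (forall i, measurable (A i)) ->
  (forall s, uniq s ->
     P (\big[setI/setT]_(i <- s) A i) = (\prod_(i <- s) q i)%:E) ->
  forall s, uniq s ->
    P (\big[setI/setT]_(i <- s) ~` A i) = (\prod_(i <- s) (1 - q i))%:E.
Proof.
move=> mA indep s us.
(* The statement is generalized to intersections of complements over [s1] and events over [s2].
   Since [X] minus [A i] has probability [P X - P (X & A i)], the induction moves [i] from [s1] to
   [s2]. *)
suff gen s1 s2 : uniq (s1 ++ s2) ->
    P ((\big[setI/setT]_(i <- s1) ~` A i) `&` \big[setI/setT]_(i <- s2) A i) =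
    ((\prod_(i <- s1) (1 - q i)) * \prod_(i <- s2) q i)%:E.
  by have := gen s [::]; rewrite cats0 !big_nil setIT mulr1; exact.
elim: s1 s2 => [|i s1 IH] s2 us12.
  by rewrite !big_nil setTI mul1r indep.
have us1i2 : uniq (s1 ++ i :: s2).
  by move: us12; rewrite (perm_uniq (permEl (perm_catCA [:: i] s1 s2))).
have us1s2 : uniq (s1 ++ s2) by move: us12 => /= /andP[].
set X := (\big[setI/setT]_(j <- s1) ~` A j) `&` \big[setI/setT]_(j <- s2) A j.
have mX : measurable X.
  by apply: measurableI; apply: bigsetI_measurable => // j _; exact: measurableC.
rewrite !big_cons -setIA setIC -/X -setDE measureD//; last first.
  by rewrite (le_lt_trans (probability_le1 P mX)) ?ltry.
have -> : X `&` A i = (\big[setI/setT]_(j <- s1) ~` A j)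
    `&` \big[setI/setT]_(j <- i :: s2) A j.
  by rewrite big_cons /X -setIA [_ `&` A i]setIC.
rewrite [X in (X - _)%E](IH s2)// [X in (_ - X)%E](IH (i :: s2))//.
by rewrite !big_cons -EFinB; congr EFin; ring.
Qed.

End independence.

Section exponential.
Context {R : realType}.

(** Apply [1 + u <= expR u] at [u = x] and at [u = x^-1]; the inverses of [1 + x] and [1 + x^-1] add
    up to 1. *)
Lemma expR_inv_le (x : R) : 0 < x -> expR (- x^-1) <= 1 - expR (- x).
Proof.
move=> x0; rewrite !expRN.
have h1 : (expR x^-1)^-1 <= (1 + x^-1)^-1.
  by rewrite lef_pV2 ?posrE ?expR_gt0 ?expR_ge1Dx// addr_gt0 ?invr_gt0.
have h2 : (expR x)^-1 <= (1 + x)^-1.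
  by rewrite lef_pV2 ?posrE ?expR_gt0 ?expR_ge1Dx// addr_gt0.
apply: (le_trans h1).
have -> : (1 + x^-1)^-1 = 1 - (1 + x)^-1.
  by field; rewrite !gt_eqF// ?addr_gt0.
by rewrite lerB.
Qed.

Lemma exponential_prob_itvNyc0 (rate : R) : 0 < rate ->
  exponential_prob rate `]-oo, 0] = 0%E.
Proof.
(* The end point 0 is removed first, because the density does not vanish there. *)
move=> rate0; rewrite /exponential_prob -integral_itv_bndo_bndc.
  apply: integral0_eq => x /=; rewrite in_itv /= => x0.
  rewrite /exponential_pdf patchE memNset//= in_itv /= andbT.
  by rewrite leNgt x0.
by apply/measurable_EFinP/measurable_funTS; exact: measurable_exponential_pdf.
Qed.

End exponential.

(** * Almost sure existence of barriers *)

Section percolation.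
Context {R : realType} {d : measure_display} {Omega : measurableType d}.
Context {P : probability Omega R} {omega : edge -> {RV P >-> R}}.
Hypothesis omega_indep : mutually_independent omega.
Hypothesis omega_exp : forall e : edge,
  exponentially_distributed (omega e) (2 ^ eheight e).

Lemma negligible_weight_le0 :
  P.-negligible (\bigcup_e [set t | omega e t <= 0]).
Proof.
apply: negligible_bigcup_countable => e.
have mA : measurable (`]-oo, 0] : set R) by exact: measurable_itv.
exists (omega e @^-1` `]-oo, 0]); split.
- by rewrite -[X in measurable X]setTI; exact: measurable_funP.
- rewrite [LHS](omega_exp e _ mA) exponential_prob_itvNyc0//.
  by rewrite exprz_gt0.
- by move=> t /= ?; rewrite in_itv.
Qed.

Section barrier.
Context (dl : R) (dl_gt0 : 0 < dl) (b : bool).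

(** The threshold is read off the height, so that the event is the preimage of a set indexed by the
    edge, as [mutually_independent] requires. Starting the interval at 0 gives a closed form for its
    probability. *)
Definition small_weight (e : edge) : set Omega :=
  omega e @^-1` `[0, threshold dl `|eheight e|%N].

Definition small_ray (N a : nat) : set Omega :=
  \big[setI/setT]_(k <- iota 0 N) small_weight (ray_edge b a k).

Definition no_small_ray (M : nat) : set Omega :=
  \big[setI/setT]_(a <- iota 0 M) ~` small_ray M.*2 a.

(** The exponent is the rate [2 ^ k.+1] times [threshold dl k.+1]. *)
Definition small_weight_prob (k : nat) : R :=
  1 - expR (- (dl * (3 / 2) ^+ k.+1)).

Lemma measurable_small_weight e : measurable (small_weight e).
Proof.
by rewrite -[X in measurable X]setTI; exact: measurable_funP.
Qed.

Lemma measurable_small_ray N a : measurable (small_ray N a).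
Proof.
by apply: bigsetI_measurable => k _; exact: measurable_small_weight.
Qed.

Lemma measurable_no_small_ray M : measurable (no_small_ray M).
Proof.
apply: bigsetI_measurable => a _; apply: measurableC.
exact: measurable_small_ray.
Qed.

Lemma probability_small_weight a k :
  P (small_weight (ray_edge b a k)) = (small_weight_prob k)%:E.
Proof.
rewrite /small_weight [LHS](omega_exp _ _ (measurable_itv _)).
rewrite eheight_ray_edge /= exponential_prob_itv0c; last first.
  by rewrite mulr_gt0// exprn_gt0.
rewrite -EFinB /small_weight_prob /threshold mulNr.
congr (1 - expR (- _))%:E.
rewrite mulrCA -exprMn; congr (_ * _ ^+ _).
by lra.
Qed.

Lemma probability_small_rays N s : uniq s ->
  P (\big[setI/setT]_(a <- s) small_ray N a) =
  (\prod_(a <- s) \prod_(k <- iota 0 N) small_weight_prob k)%:E.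
Proof.
move=> us.
(* The double intersection is flattened into one over a list of distinct edges, to which
   independence applies directly. *)
rewrite /small_ray -(big_allpairs_dep (h := ray_edge b) (r2 := fun=> iota 0 N)).
rewrite -bigcap_seq omega_indep.
- rewrite (big_allpairs_dep (h := ray_edge b) (r2 := fun=> iota 0 N)).
  rewrite -prodEFin; apply: eq_bigr => a _.
  rewrite -prodEFin; apply: eq_bigr => k _.
  exact: probability_small_weight.
- apply: allpairs_uniq => //; first exact: iota_uniq.
  by move=> [a k] [a' k'] _ _ /= /ray_edge_inj[-> ->].
- by move=> e; exact: measurable_itv.
Qed.

(* By [expR_inv_le] the product is at least
   [exp (- sum_k (2/3)^(k+1) / dl) = exp (- 2 (1 - (2/3)^N) / dl)]. *)
Lemma small_ray_prob_ge N :
  expR (- (2 / dl)) <= \prod_(k <- iota 0 N) small_weight_prob k.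
Proof.
apply: (@le_trans _ _ (expR (- (2 * (1 - (2 / 3) ^+ N) / dl)))).
  rewrite ler_expR lerN2 ler_wpM2r ?invr_ge0 ?(ltW dl_gt0)//.
  by rewrite -[leRHS]mulr1 ler_wpM2l// gerBl exprn_ge0.
elim: N => [|N IH]; first by rewrite big_nil expr0 subrr mulr0 mul0r oppr0 expR0.
rewrite -[in X in _ <= X]addn1 iotaD big_cat big_seq1 add0n /=.
have -> : - (2 * (1 - (2 / 3) ^+ N.+1) / dl) =
    - (2 * (1 - (2 / 3) ^+ N) / dl) + - (dl * (3 / 2) ^+ N.+1)^-1.
  rewrite invfM -exprVn invf_div exprS; field; exact: lt0r_neq0.
rewrite expRD ler_pM ?expR_ge0//.
by apply: expR_inv_le; rewrite mulr_gt0// exprn_gt0.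
Qed.

(** The [M] rays fail independently. The bound on each failure does not depend on the ray length,
    which may therefore grow with [M]. *)
Lemma no_small_ray_le M :
  (P (no_small_ray M) <= ((1 - expR (- (2 / dl))) ^+ M)%:E)%E.
Proof.
rewrite (probability_bigsetI_setC P _ _ _ (measurable_small_ray _)
  (probability_small_rays _))// ?iota_uniq//.
rewrite lee_fin big_const_seq count_predT size_iota iter_mulr_1.
apply: lerXn2r; rewrite ?nnegrE.
- rewrite subr_ge0; apply: prodr_ile1 => k _.
  rewrite subr_ge0 gerBl expR_ge0 andbT -[leRHS]expR0 ler_expR oppr_le0.
  by rewrite mulr_ge0 ?exprn_ge0// ltW.
- by rewrite subr_ge0 -[leRHS]expR0 ler_expR oppr_le0 divr_ge0// ltW.
- by rewrite lerB// small_ray_prob_ge.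
Qed.

End barrier.

(** Outside this event, some [M] provides a small ray of each direction, and the two form a
    barrier. *)
Definition unbounded_growth (dl : R) : set Omega :=
  \bigcap_M (no_small_ray dl true M `|` no_small_ray dl false M).

Lemma negligible_unbounded_growth (dl : R) : 0 < dl ->
  P.-negligible (unbounded_growth dl).
Proof.
move=> dl_gt0; set q := 1 - expR (- (2 / dl)).
have q01 : `|q| < 1.
  have e0 : 0 < expR (- (2 / dl)) by exact: expR_gt0.
  have e1 : expR (- (2 / dl)) <= 1.
    by rewrite -[leRHS]expR0 ler_expR oppr_le0 divr_ge0// ltW.
  by rewrite ger0_norm /q; lra.
have mU M : measurable (no_small_ray dl true M `|` no_small_ray dl false M).
  by apply: measurableU; exact: measurable_no_small_ray.
have mG : measurable (unbounded_growth dl) by exact: bigcap_measurableType.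
exists (unbounded_growth dl); split => //.
(* Union bound over the two directions; the right-hand side tends to 0 as [M] grows. *)
have PG M : (P (unbounded_growth dl) <= (2 * q ^+ M)%:E)%E.
  apply: (@le_trans _ _ (P (no_small_ray dl true M `|` no_small_ray dl false M))).
    by apply: le_measure; rewrite ?inE// => t; exact.
  have m b := measurable_no_small_ray dl b M.
  apply: (le_trans (measureU2 _ (m true) (m false))).
  by rewrite mulr2n mulrDl mul1r EFinD leeD// no_small_ray_le.
have Pfin : P (unbounded_growth dl) \is a fin_num by exact: fin_num_measure.
apply/eqP; rewrite eq_le measure_ge0 andbT -(fineK Pfin) lee_fin.
have cvg0 : 2 * q ^+ M @[M --> \oo] --> (0 : R).
  by rewrite -[X in _ --> X](mulr0 2); apply: cvgMr; exact: cvg_expr.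
rewrite -(cvg_lim _ cvg0)//; apply: limr_ge; first by apply/cvg_ex; exists 0.
by apply: nearW => M; rewrite -lee_fin fineK.
Qed.

Lemma small_rayP (dl : R) (b : bool) (N a : nat) (t : Omega) :
  small_ray dl b N a t ->
  forall k, (k < N)%N -> omega (ray_edge b a k) t <= threshold dl k.+1.
Proof.
rewrite /small_ray -bigcap_seq => small k kN.
have /small : k \in iota 0 N by rewrite mem_iota.
by rewrite /small_weight /= eheight_ray_edge in_itv => /andP[].
Qed.

Lemma ex_small_ray (dl : R) (b : bool) (M : nat) (t : Omega) :
  ~ no_small_ray dl b M t ->
  exists2 a, (a < M)%N & small_ray dl b M.*2 a t.
Proof.
rewrite /no_small_ray -bigcap_seq => /existsNP[a /not_implyP[aM /contrapT ta]].
by exists a => //; move: aM; rewrite /= mem_iota.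
Qed.

Lemma finite_Sset_of_barrier (t : Omega) (dl : R) :
  (forall e, 0 < omega e t) ->
  0 < dl -> (forall b, 3 * dl < omega (out_edge b origin) t) ->
  ~ unbounded_growth dl t -> finite_set (Sset (fun e => omega e t) origin).
Proof.
move=> w0 dl0 wdl /existsNP[M /not_implyP[_ /not_orP[]]].
move=> /ex_small_ray[a aM ta] /ex_small_ray[c cM tc].
apply: (@finite_Sset _ _ _ dl (fun b => if b then a else c)) => //.
- by move=> e; exact: ltW.
- exact: ltW.
(* The indices [a] and [c] are below [M], so [a.+1 + c.+1 <= M.*2]: rays of length [M.*2] are long
   enough. *)
- by move=> [] i iM; [apply: small_rayP ta _ _|apply: small_rayP tc _ _]; lia.
Qed.

End percolation.

Theorem theorem4p1 (R : realType) (d : measure_display) (Omega : measurableType d)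
    (P : probability Omega R) (omega : edge -> {RV P >-> R})
    (omega_indep : mutually_independent omega)
    (omega_exp : forall e : edge,
      exponentially_distributed (omega e) (2 ^ eheight e)) :
  {ae P, forall t : Omega, finite_set (Sset (fun e => omega e t) origin)}.
Proof.
(* The suitable [dl] depends on the outcome; restricting it to the values [j.+1%:R^-1] leaves a
   countable union of negligible events. *)
have dl_gt0 j : 0 < (j.+1%:R^-1 : R) by rewrite invr_gt0.
apply: (negligibleS _ (negligibleU (negligible_weight_le0 omega_exp)
  (negligible_bigcup (fun j =>
     negligible_unbounded_growth omega_indep omega_exp _ (dl_gt0 j))))).
move=> t /= tinf; apply: contrapT => /not_orP[tw tg]; apply: tinf.
have w0 e : 0 < omega e t.
  by rewrite ltNge; apply/negP => et; apply: tw; exists e.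
(* The lighter of the two edges leaving the origin dictates [dl < m / 3]. *)
pose m := Num.min (omega (out_edge true origin) t)
  (omega (out_edge false origin) t).
have m3 : 0 < m / 3 by rewrite divr_gt0// lt_min !w0.
have [j] := ltr_add_invr m3; rewrite add0r ltr_pdivlMr// mulrC => jm.
apply: (@finite_Sset_of_barrier _ _ _ _ _ _ j.+1%:R^-1) => //.
- move=> b; apply: lt_le_trans jm _.
  by rewrite ge_min; case: b; rewrite lexx ?orbT.
- by move=> tj; apply: tg; exists j.
Qed.
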